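(* Let $R$ be a commutative ring in which every nonzero nilpotent element $r\in Nil(R)$ has degree of nilpotency greater than $2$. If $R$ is a Nil-semicommutative ring, then $R$, regarded as a left module over itself, is a Nil-semicommutative module.
   Context: Rings are associative with identity and modules are unitary left modules. $Nil(R)$ denotes the set of nilpotent elements of the ring $R$; the degree of nilpotency of $r\in Nil(R)$ is the least positive integer $n$ with $r^n=0$. A ring $R$ is Nil-semicommutative if whenever $a,b\in R$ satisfy $ab\in Nil(R)$, one has $aRb\subseteq Nil(R)$. For a left module $M$ over a ring $R$, an element $m\in M$ is called nilpotent if either $m=0$, or $m\neq 0$ and there exist $r\in R$ and $k\in\mathbb{N}$ (positive integer) such that $r^k m=0$ but $rm\neq 0$. $Nil_R(M)$ denotes the set of all nilpotent elements of the module $M$. A left $R$-module $M$ is Nil-semicommutative if whenever $a\in R$ and $m\in M$ satisfy $am\in Nil_R(M)$, one has $aRm\subseteq Nil_R(M)$, where $aRm=\{atm : t\in R\}$. *)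

(* Defs.v *)
From HB Require Import structures.
From mathcomp Require Import all_boot all_order all_algebra.

Set Implicit Arguments.
Unset Strict Implicit.
Unset Printing Implicit Defensive.

Import GRing.Theory.
Local Open Scope ring_scope.

(* [pzRingType] is the structure of associative unital rings, the zero ring
   included. *)

Definition nil_elt (R : pzRingType) (r : R) : Prop :=
  exists n : nat, (0 < n)%N /\ r ^+ n = 0.

Definition nilpotency_degree (R : pzRingType) (r : R) (n : nat) : Prop :=
  [/\ (0 < n)%N, r ^+ n = 0
    & forall k : nat, (0 < k)%N -> r ^+ k = 0 -> (n <= k)%N].

Definition nil_semicommutative_ring (R : pzRingType) : Prop :=
  forall a b : R, nil_elt (a * b) -> forall t : R, nil_elt (a * t * b).

Definition nil_mod_elt (R : pzRingType) (M : lmodType R) (m : M) : Prop :=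
  m = 0 \/
  (m <> 0 /\
   exists (r : R) (k : nat), [/\ (0 < k)%N, r ^+ k *: m = 0 & r *: m <> 0]).

Definition nil_semicommutative_module (R : pzRingType) (M : lmodType R) : Prop :=
  forall (a : R) (m : M),
    nil_mod_elt (a *: m) -> forall t : R, nil_mod_elt ((a * t) *: m).

(* Main.v *)
Require Import Defs.
From HB Require Import structures.
From mathcomp Require Import all_boot all_order all_algebra.
Import GRing.Theory.
Local Open Scope ring_scope.

(** The degree hypothesis forces [R] to be reduced: a nonzero element of square
    zero would have degree exactly 2, and a ring without such elements has no
    nonzero nilpotents at all ([square_free_reduced]).  Over a commutative
    reduced ring the regular module has no nonzero nilpotent element either
    ([reduced_nil_mod_elt]), because [r ^+ k * m = 0] makes [r * m] nilpotent.
    The module condition thus says that [a * m = 0] implies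
    [a * t * m = 0], which is commutativity. *)

Lemma sqr0_of_degree_gt2 (R : pzRingType) (r : R) :
    (r <> 0 -> forall n : nat, nilpotency_degree r n -> (2 < n)%N) ->
  r ^+ 2 = 0 -> r = 0.
Proof.
move=> hdeg r2; apply/eqP/negP => /negP /eqP r0.
suff /(hdeg r0) : nilpotency_degree r 2 by [].
by split=> // -[|[|k]] //; rewrite expr1.
Qed.

(** If [r ^+ n.+2 = 0], then [r ^+ n.+1] has square zero since
    [n.+2 <= 2 * n.+1]; so the exponent can be lowered step by step to 1. *)
Lemma square_free_reduced (R : pzRingType) :
    (forall r : R, r ^+ 2 = 0 -> r = 0) ->
  forall (r : R) (n : nat), r ^+ n.+1 = 0 -> r = 0.
Proof.
move=> sqr0 r; elim=> [|n IHn] rn; first by rewrite -[r]expr1.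
by apply/IHn/sqr0; rewrite -exprM muln2 doubleS -addnn -!addSn exprD rn mul0r.
Qed.

(** Multiplying [r ^+ k * m = 0] by [m ^+ k.-1] gives [(r * m) ^+ k = 0], which
    contradicts [r * m <> 0]. *)
Lemma reduced_nil_mod_elt (R : comPzRingType) (m : R^o) :
    (forall (r : R) (n : nat), r ^+ n.+1 = 0 -> r = 0) ->
  nil_mod_elt m -> m = 0.
Proof.
move=> red [//|[_ [r [[|k] [// _ rkm rm]]]]]; case: rm.
apply: (red _ k).
by rewrite exprMn [m ^+ _]exprS mulrA [_ * m]rkm mul0r.
Qed.

Theorem proposition2p5 (R : comPzRingType)
    (hdeg : forall r : R, nil_elt r -> r <> 0 ->
              forall n : nat, nilpotency_degree r n -> (2 < n)%N)
    (hR : nil_semicommutative_ring R) :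
  nil_semicommutative_module R^o.
Proof.
have red : forall (r : R) (n : nat), r ^+ n.+1 = 0 -> r = 0.
  apply: square_free_reduced => r r2; apply: sqr0_of_degree_gt2 (r2).
  by apply: hdeg; exists 2.
move=> a m /(reduced_nil_mod_elt _ _ red) am t; left.
by rewrite [a * t]mulrC -scalerA am scaler0.
Qed.
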